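(* Let $X$ be a real Banach space and let $f:[a,b]\to X$ be such that $md(f,x)=1$ for each $x\in[a,b]$. Then the set of points $x\in[a,b]$ such that $f$ is not metrically differentiable at $x$ is $\sigma$-symmetrically porous.
   Context: For $f:[a,b]\to X$, the unilateral metric derivatives are $md_{\pm}(f,x)=\lim_{t\to0+}\frac{\|f(x\pm t)-f(x)\|}{t}$. If both exist and are equal (and finite), their common value is the metric derivative $md(f,x)$; at an endpoint of $[a,b]$ only the one-sided limit taken inside $[a,b]$ is used. The mapping $f$ is metrically differentiable at $x$ if $md(f,x)$ exists and $\|f(y)-f(z)\|-md(f,x)|y-z|=o(|y-x|+|z-x|)$ as $(y,z)\to(x,x)$ with $y,z\in[a,b]$. Symmetric porosity: for $M\subset\mathbb{R}$, $x\in M$, $R>0$, let $S\gamma(x,R,M)$ be the supremum of all $r>0$ for which there exists $z\in\mathbb{R}$ with $B(z,r)\cup B(2x-z,r)\subset B(x,R)\setminus M$, where $B(z,r)=(z-r,z+r)$ (the supremum is $0$ if there is no such $r$). The symmetric upper porosity of $M$ at $x$ is $S\overline{p}(M,x)=2\limsup_{R\to0+}S\gamma(x,R,M)/R$. The set $M$ is symmetrically porous if $S\overline{p}(M,x)>0$ for all $x\in M$. A set is $\sigma$-symmetrically porous if it is a countable union of symmetrically porous sets. *)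

(* Defs.v *)
From HB Require Import structures.
From mathcomp Require Import all_boot all_order all_algebra.
From mathcomp Require Import all_classical all_reals all_analysis.

Set Implicit Arguments.
Unset Strict Implicit.
Unset Printing Implicit Defensive.

Import Order.TTheory GRing.Theory Num.Theory.
Import numFieldNormedType.Exports.

Local Open Scope classical_set_scope.
Local Open Scope ring_scope.

(* A mapping [a, b] -> X is represented by a total function f : R -> X; the
   values of f outside [a, b] play no role in the definitions below. *)
Section MetricDerivative.
Context {R : realType} {X : normedModType R}.
Implicit Types (a b x l : R) (f : R -> X).

Definition is_md_right f x l : Prop :=
  `|f (x + t) - f x| / t @[t --> 0^'+] --> l.

Definition is_md_left f x l : Prop :=
  `|f (x - t) - f x| / t @[t --> 0^'+] --> l.

(* Meant for a < b, so that at least one of the two limits is required and l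
   is unique. *)
Definition is_md a b f x l : Prop :=
  [/\ x \in `[a, b], x < b -> is_md_right f x l & a < x -> is_md_left f x l].

Definition metrically_differentiable a b f x : Prop :=
  exists2 l : R, is_md a b f x l &
    (fun p : R * R => `|f p.1 - f p.2| - l * `|p.1 - p.2|)
    =o_ (within (`[a, b] `*` `[a, b]) (nbhs (x, x)))
    (fun p : R * R => `|p.1 - x| + `|p.2 - x|).

End MetricDerivative.

Section SymmetricPorosity.
Context {R : realType}.
Implicit Types (x r : R) (M : set R).

(* The set is bounded above by r, and the real-valued sup of the empty set
   is 0. *)
Definition Sgamma x r M : R :=
  sup [set s : R | 0 < s /\
    exists z : R, ball z s `|` ball (2 * x - z) s `<=` ball x r `\` M].

Definition symmetric_upper_porosity M x : \bar R :=
  (2%:E * limf_esup (fun r : R => (Sgamma x r M / r)%:E) 0^'+)%E.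

Definition symmetrically_porous M : Prop :=
  forall x, M x -> (0 < symmetric_upper_porosity M x)%E.

Definition sigma_symmetrically_porous M : Prop :=
  exists2 A : nat -> set R,
    (forall n, symmetrically_porous (A n)) & M = \bigcup_n A n.

End SymmetricPorosity.

(* Main.v *)
(** Since the metric derivative is everywhere [1], [f] is 1-Lipschitz. If [f] is
    not metrically differentiable at [x], there are arbitrarily close pairs
    [y, z] whose chord [|f y - f z|] is shorter than [|y - z|] by a fixed
    proportion; as [|f t - f x|] is almost [|t - x|], such a pair must have [x]
    strictly in between, and by the Lipschitz property it may be enlarged to a
    pair [x - h, x + h] with a chord still too short. A point [w] close to
    [x + h] (relative to [h]) then has a short chord to [x - h], so [w] is
    excluded as soon as [|f t - f w|] is almost [|t - w|] at a uniform scale;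
    likewise near [x - h]. Hence the points sharing the same defect and the same
    scale form a symmetrically porous set. *)

Require Import Defs.
From mathcomp Require Import all_boot all_order all_algebra.
From mathcomp Require Import all_classical all_reals all_analysis.
From mathcomp Require Import lra.
Import Order.TTheory GRing.Theory Num.Theory.
Import numFieldNormedType.Exports.
Local Open Scope classical_set_scope.
Local Open Scope ring_scope.

Lemma cvg_quotient_right {R : realType} {g : R -> R} {l e : R} :
  g t / t @[t --> 0^'+] --> l -> 0 < e ->
  exists2 d, 0 < d & forall t, 0 < t -> t < d -> `|g t - l * t| <= e * t.
Proof.
move=> /cvgrPdist_le gl e0; have [d /= d0 gd] := gl _ e0.
exists d => // t t0 td.
have /= := gd t; rewrite sub0r normrN gtr0_norm// => /(_ td t0).
have -> : g t - l * t = (g t / t - l) * t by rewrite mulrBl divfK ?gt_eqF.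
by rewrite normrM (gtr0_norm t0) ler_pM2r// distrC.
Qed.

Lemma is_md_near {R : realType} {X : normedModType R} {a b x l e : R}
    {f : R -> X} :
  is_md a b f x l -> 0 < e ->
  exists2 d, 0 < d & forall y, a <= y <= b -> `|y - x| < d ->
    `| `|f y - f x| - l * `|y - x| | <= e * `|y - x|.
Proof.
case=> _ rgt lft e0.
have [d1 d10 H1] : exists2 d, 0 < d & forall t, 0 < t -> t < d -> x + t <= b ->
    `| `|f (x + t) - f x| - l * t | <= e * t.
  have [xb|bx] := ltP x b; last by exists 1 => // t t0 _; lra.
  have [d d0 H] := cvg_quotient_right (rgt xb) e0.
  by exists d => // t t0 td _; exact: H.
have [d2 d20 H2] : exists2 d, 0 < d & forall t, 0 < t -> t < d -> a <= x - t ->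
    `| `|f (x - t) - f x| - l * t | <= e * t.
  have [ax|xa] := ltP a x; last by exists 1 => // t t0 _; lra.
  have [d d0 H] := cvg_quotient_right (lft ax) e0.
  by exists d => // t t0 td _; exact: H.
exists (Num.min d1 d2); first by rewrite lt_min d10.
move=> y /andP[ay yb]; rewrite lt_min => /andP[yd1 yd2].
have [xy|yx|->] := ltgtP x y; last by rewrite !subrr !normr0 !mulr0 subrr normr0.
- rewrite (@gtr0_norm _ (y - x)) ?subr_gt0// in yd1 *.
  by have := H1 (y - x); rewrite subrKC; apply=> //; rewrite subr_gt0.
- rewrite distrC gtr0_norm ?subr_gt0// in yd2.
  rewrite (distrC y) (@gtr0_norm _ (x - y)) ?subr_gt0//.
  by have := H2 (x - y); rewrite subKr; apply=> //; rewrite subr_gt0.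
Qed.

(* The supremum of the [t] in [[y, z]] with [|f t - f y| <= c * (t - y)] belongs
   to the set by the estimate to its left, and equals [z] by the estimate to its
   right. *)
Lemma dist_le_of_local {R : realType} {X : normedModType R} {y z c : R}
    {f : R -> X} :
  0 <= c -> y <= z ->
  (forall x, y <= x <= z -> exists2 d, 0 < d &
    forall t, y <= t <= z -> `|t - x| < d -> `|f t - f x| <= c * `|t - x|) ->
  `|f z - f y| <= c * (z - y).
Proof.
move=> c0 yz loc.
pose S := [set t : R | y <= t <= z /\ `|f t - f y| <= c * (t - y)].
have Sy : S y by split; rewrite ?lexx//= !subrr normr0 mulr0.
have hS : has_sup S by split; [exists y | exists z => t [/andP[]]].
set s := sup S.
have ys : y <= s by exact: ub_le_sup hS.2 _ Sy.
have sz : s <= z by apply: ge_sup; [exists y | move=> t [/andP[]]].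
have [d d0 sd] := loc s (introT andP (conj ys sz)).
have [t St st] := sup_adherent d0 hS; rewrite -/s in st.
have ts : t <= s by exact: ub_le_sup hS.2 _ St.
have chain u v w : `|f v - f u| <= c * (v - u) ->
    `|f w - f v| <= c * (w - v) -> `|f w - f u| <= c * (w - u).
  by move=> h1 h2; have := ler_distD (f v) (f w) (f u); lra.
case: St => /andP[yt tz] St.
have Ss : S s.
  split; first by rewrite ys.
  apply: (chain y t s) => //.
  have := sd t; rewrite yt tz (distrC t) (distrC (f t)) ger0_norm ?subr_ge0//.
  by apply=> //; lra.
have [zs|sltz] := leP z s.
  have <- : s = z by apply/eqP; rewrite eq_le sz zs.
  by case: Ss => [_ +].
pose w := Num.min z (s + d / 2).
have sw : s < w by rewrite lt_min sltz /=; lra.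
have [wz wd] : w <= z /\ w <= s + d / 2 by rewrite !ge_min !lexx orbT.
suff Sw : S w by have : w <= s := ub_le_sup hS.2 Sw; lra.
split; first by lra.
apply: (chain y s w); first by case: Ss => [_ +].
have ws : 0 <= w - s by lra.
by have := sd w; rewrite (ger0_norm ws); apply; lra.
Qed.

Lemma md1_nonexpansive {R : realType} {X : normedModType R} {a b : R}
    {f : R -> X} :
  (forall x, x \in `[a, b] -> is_md a b f x 1) ->
  forall y z, a <= y <= b -> a <= z <= b -> `|f z - f y| <= `|z - y|.
Proof.
move=> hmd.
suff H y z : a <= y -> y <= z -> z <= b -> `|f z - f y| <= z - y.
  move=> y z /andP[ay yb] /andP[az zb]; have [yz|zy] := leP y z.
    by apply: le_trans (H _ _ ay yz zb) (ler_norm _).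
  rewrite distrC (distrC z).
  by apply: le_trans (H _ _ az (ltW zy) yb) (ler_norm _).
move=> ay yz zb; apply/ler_addgt0Pl => e e0.
have k0 : 0 < z - y + 1 by lra.
pose k := e / (z - y + 1).
have kp : 0 < k by rewrite divr_gt0.
have : `|f z - f y| <= (1 + k) * (z - y).
  apply: dist_le_of_local => //; first by lra.
  move=> x /andP[yx xz].
  have xab : x \in `[a, b] by rewrite in_itv /=; lra.
  have [d d0 H] := is_md_near (hmd _ xab) kp.
  exists d => // t /andP[yt tz] td.
  have tab : a <= t <= b by lra.
  have := H t tab td; rewrite ler_norml; lra.
have : k * (z - y + 1) = e by rewrite divfK// gt_eqF.
lra.
Qed.

Lemma Sgamma_ge {R : realType} {x z s r : R} {M : set R} :
  0 < s -> ball z s `|` ball (2 * x - z) s `<=` ball x r `\` M ->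
  s <= Sgamma x r M.
Proof.
move=> s0 sub; apply: ub_le_sup; last by split => //; exists z.
exists r => t [t0 [w wsub]].
have /wsub[+ _] : (ball w t `|` ball (2 * x - w) t) w.
  by left; exact: ballxx.
rewrite /ball /= => wx.
have in_ball u : `|w - u| < t -> `|x - u| < r.
  by move=> wu; have [] : (ball x r `\` M) u by apply: wsub; left.
rewrite leNgt; apply/negP => rt.
have [h1 h2] : `|w - (w + r)| < t /\ `|w - (w - r)| < t.
  have r0 : 0 < r by apply: le_lt_trans wx.
  by split; rewrite ltr_norml; lra.
have := in_ball _ h1; have := in_ball _ h2; rewrite !ltr_norml; lra.
Qed.

Lemma symmetric_upper_porosity_gt0 {R : realType} {x c : R} {M : set R} :
  0 < c ->
  (forall d, 0 < d -> exists r, [/\ 0 < r, r < d & c * r <= Sgamma x r M]) ->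
  (0 < symmetric_upper_porosity M x)%E.
Proof.
move=> c0 H.
have le : (c%:E <= limf_esup (fun r : R => (Sgamma x r M / r)%:E) 0^'+)%E.
  apply: le_ereal_inf_tmp => _ [V [d /= d0 Vd] <-].
  have [r [r0 rd cr]] := H _ d0.
  have Vr : V r by apply: Vd => //=; rewrite sub0r normrN gtr0_norm.
  apply: le_trans (ereal_sup_ubound _); last by exists r.
  by rewrite lee_fin ler_pdivlMr.
rewrite /symmetric_upper_porosity mule_gt0//.
by apply: lt_le_trans le; rewrite lte_fin.
Qed.

Definition chord_defect_set {R : realType} {X : normedModType R} (a b : R)
    (f : R -> X) (e d : R) : set R :=
  [set x | [/\ a <= x <= b,
    forall r, 0 < r -> exists h,
      [/\ 0 < h, h < r, a <= x - h, x + h <= b &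
          `|f (x + h) - f (x - h)| <= (2 - e) * h] &
    forall t, a <= t <= b -> `|t - x| < d ->
      (1 - e / 8) * `|t - x| <= `|f t - f x|]].

Lemma chord_defect_avoids {R : realType} {X : normedModType R}
    {a b e d u v w : R} {f : R -> X} :
  (forall y z, a <= y <= b -> a <= z <= b -> `|f z - f y| <= `|z - y|) ->
  0 < e <= 1 -> a <= u <= b -> a <= v <= b ->
  `|f u - f v| <= (1 - e / 2) * `|u - v| -> 2 * `|u - v| < d ->
  `|u - w| < e / 16 * `|u - v| -> ~ chord_defect_set a b f e d w.
Proof.
move=> lip /andP[e0 e1] uab vab uv uvd uw [wab _ low].
have h0 : 0 <= `|u - v| by [].
have eh : e * `|u - v| <= `|u - v| by rewrite ler_piMl.
have wv := ler_distD u w v; have uv' := ler_distD w u v.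
rewrite (distrC w u) in wv.
have := low v vab; rewrite (distrC v w) (distrC (f v)) => lowv.
have /lowv {}lowv : `|w - v| < d by lra.
have := lip u w uab wab; rewrite (distrC w) => fwu.
have fwv := ler_distD (f u) (f w) (f v).
have : (1 - e / 8) * (`|u - v| - `|u - w|) <= (1 - e / 8) * `|w - v|.
  by rewrite ler_pM2l; lra.
have : 0 <= e * `|u - w| by rewrite mulr_ge0// ltW.
lra.
Qed.

Lemma chord_defect_porous {R : realType} {X : normedModType R} {a b e d : R}
    {f : R -> X} {M : set R} :
  (forall y z, a <= y <= b -> a <= z <= b -> `|f z - f y| <= `|z - y|) ->
  0 < e <= 1 -> 0 < d -> M `<=` chord_defect_set a b f e d ->
  symmetrically_porous M.
Proof.
move=> lip e01 d0 MD x /MD[xab chord _].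
have /andP[e0 e1] := e01.
apply: (@symmetric_upper_porosity_gt0 _ _ (e / 16)); first by lra.
move=> r r0.
have m0 : 0 < Num.min r d / 4 by rewrite divr_gt0// lt_min r0.
have [h [h0]] := chord _ m0.
rewrite ltr_pdivlMr// lt_min => /andP[hr hd] ah hb fh.
have eh : e * h <= h by rewrite ler_piMl// ltW.
exists (2 * h); split; [lra | lra |].
apply: (@Sgamma_ge _ _ (x + h)); first by rewrite !mulr_gt0//; lra.
have dist : `|(x + h) - (x - h)| = 2 * h.
  by rewrite gtr0_norm; lra.
move=> w; rewrite /ball /= => near; split.
  by case: near; rewrite /ball /= !ltr_norml; lra.
move=> /MD; case: near => near.
  apply: (chord_defect_avoids lip e01 (u := x + h) (v := x - h));
    rewrite ?dist//; lra.
apply: (chord_defect_avoids lip e01 (u := x - h) (v := x + h));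
  rewrite 1?(distrC (x - h) (x + h)) 1?(distrC (f (x - h))) ?dist//; try lra.
by move: near; have -> : 2 * x - (x + h) = x - h by lra.
Qed.

Lemma not_md_straddle {R : realType} {X : normedModType R} {a b x : R}
    {f : R -> X} :
  (forall y z, a <= y <= b -> a <= z <= b -> `|f z - f y| <= `|z - y|) ->
  is_md a b f x 1 -> ~ metrically_differentiable a b f x ->
  exists2 e, 0 < e & forall r, 0 < r -> exists y z,
    [/\ a <= y < x, x < z <= b, z - y < r &
        `|f z - f y| < z - y - e * (z - y)].
Proof.
move=> lip md1 nmd.
have [e e0 bad] : exists2 e, 0 < e & forall r, 0 < r -> exists y z,
    [/\ a <= y <= b, a <= z <= b, `|y - x| < r, `|z - x| < r &
        `|f y - f z| < `|y - z| - e * (`|y - x| + `|z - x|)].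
  apply: contrapT => /forall2NP none; apply: nmd; exists 1 => //.
  apply/eqoP => e e0; have [//|/existsNP[r /not_implyP[r0 nbad]]] := none e.
  rewrite /= near_withinE; apply/nbhs_ballP; exists r => //= -[y z] /=.
  rewrite /ball /= /prod_ball /ball /= => -[yx zx] [yab zab].
  rewrite !in_itv /= in yab zab.
  have yz := lip _ _ zab yab.
  rewrite mul1r ler0_norm ?subr_le0// opprB.
  rewrite (@ger0_norm _ (`|y - x| + `|z - x|)) ?addr_ge0//.
  rewrite leNgt; apply/negP => far; apply: nbad; exists y, z.
  by split=> //; [rewrite distrC | rewrite distrC | lra].
exists e => // r r0.
have [d d0 near] := is_md_near md1 e0.
pose q := Num.min (r / 2) d.
have q0 : 0 < q by rewrite lt_min d0 divr_gt0.
have [y [z [yab zab yq zq fyz]]] := bad _ q0.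
wlog yz : y z yab zab yq zq fyz / y <= z.
  move=> W; have [yz|/ltW zy] := leP y z; first exact: (W y z).
  by apply: (W z y) => //; rewrite (distrC (f z)) (distrC z) (addrC `|z - x|).
have xab : a <= x <= b by case: md1; rewrite in_itv.
have {}near t : a <= t <= b -> `|t - x| < q ->
    `|t - x| - e * `|t - x| <= `|f t - f x|.
  move=> tab; rewrite lt_min => /andP[_ td].
  by have := near t tab td; rewrite ler_norml; lra.
have ny := near y yab yq; have nz := near z zab zq.
have fyx := lip _ _ xab yab; have fzx := lip _ _ xab zab.
have t1 := ler_distD (f z) (f y) (f x); have t2 := ler_distD (f y) (f z) (f x).
rewrite (distrC (f z) (f y)) in t2.
have [qr qd] : q <= r / 2 /\ q <= d by rewrite !ge_min !lexx orbT.
have ey : 0 <= e * `|y - x| by rewrite mulr_ge0// ltW.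
have ez : 0 <= e * `|z - x| by rewrite mulr_ge0// ltW.
have yzE : `|y - z| = z - y by rewrite distrC ger0_norm ?subr_ge0.
have [xy|yx] := leP x y.
  have zE : `|z - x| = z - x by rewrite ger0_norm; lra.
  have yE : `|y - x| = y - x by rewrite ger0_norm; lra.
  lra.
have yE : `|y - x| = x - y by rewrite distrC gtr0_norm ?subr_gt0.
have [zx|xz] := leP z x.
  have zE : `|z - x| = x - z by rewrite distrC ger0_norm; lra.
  lra.
have zE : `|z - x| = z - x by rewrite gtr0_norm ?subr_gt0.
rewrite yE zE in fyz.
by exists y, z; split; [lra | lra | lra | rewrite distrC; lra].
Qed.

Lemma not_md_chord_defect {R : realType} {X : normedModType R} {a b x : R}
    {f : R -> X} :
  (forall y z, a <= y <= b -> a <= z <= b -> `|f z - f y| <= `|z - y|) ->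
  is_md a b f x 1 -> ~ metrically_differentiable a b f x ->
  exists n m, chord_defect_set a b f n.+1%:R^-1 m.+1%:R^-1 x.
Proof.
move=> lip md1 nmd.
have xab : a <= x <= b by case: md1; rewrite in_itv.
have [e e0 bad] := not_md_straddle lip md1 nmd.
have [n ne] : exists n, n.+1%:R^-1 < e.
  by have [n _ /(_ _ (leqnn n))] := near_infty_natSinv_lt (PosNum e0); exists n.
have n0 : 0 < n.+1%:R^-1 / 8 :> R by rewrite divr_gt0// invr_gt0.
have [d d0 near] := is_md_near md1 n0.
have [m md] : exists m, m.+1%:R^-1 < d.
  by have [m _ /(_ _ (leqnn m))] := near_infty_natSinv_lt (PosNum d0); exists m.
exists n, m; set k : R := n.+1%:R^-1 in ne n0 near *.
split => //; last first.
  move=> t tab tm; have := near t tab (lt_trans tm md).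
  by rewrite ler_norml; lra.
move=> r r0.
have [y0 [z0 [/andP[ay0 y0x] /andP[xz0 z0b] _ _]]] := bad _ r0.
pose q := Num.min r (Num.min (x - a) (b - x)).
have q0 : 0 < q by rewrite !lt_min r0 !subr_gt0 (le_lt_trans ay0) ?(lt_le_trans xz0).
have [y [z [/andP[ay yx] /andP[xz zb] zyq fzy]]] := bad _ q0.
move: zyq; rewrite !lt_min => /and3P[zyr zya zyb].
(* Enlarging [[y, z]] to [[x - h, x + h]] lengthens the chord by at most the
   added length, so the absolute defect is kept. *)
pose h := Num.max (z - x) (x - y).
have [zh yh] : z - x <= h /\ x - y <= h by rewrite !le_max !lexx orbT.
have hs : h <= z - y by rewrite ge_max; lra.
exists h; split; [lra | lra | lra | lra |].
have f1 := lip z (x + h); have f2 := lip (x - h) y.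
rewrite (@ger0_norm _ (x + h - z)) in f1; last by lra.
rewrite (@ger0_norm _ (y - (x - h))) in f2; last by lra.
have t1 := ler_distD (f z) (f (x + h)) (f (x - h)).
have t2 := ler_distD (f y) (f z) (f (x - h)).
have eh : e * h <= e * (z - y) by rewrite ler_pM2l.
have nh : k * h <= e * h by rewrite ler_pM2r ?ltW//; lra.
have {}f1 : `|f (x + h) - f z| <= x + h - z by apply: f1; lra.
have {}f2 : `|f y - f (x - h)| <= y - (x - h) by apply: f2; lra.
lra.
Qed.

Theorem proposition4p5 (R : realType) (X : completeNormedModType R)
    (a b : R) (f : R -> X) (hab : a < b)
    (hmd : forall x : R, x \in `[a, b] -> is_md a b f x 1) :
  sigma_symmetrically_porous
    [set x : R | x \in `[a, b] /\ ~ metrically_differentiable a b f x].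
Proof.
have lip := md1_nonexpansive hmd.
set E := [set x | _].
pose A k := if unpickle k is Some (n, m) then
  E `&` chord_defect_set a b f n.+1%:R^-1 m.+1%:R^-1 else set0.
exists A => [k|].
  rewrite /A; case: unpickle => [[n m]|//].
  apply: (chord_defect_porous lip) (@subIsetr _ _ _); last by rewrite invr_gt0.
  by rewrite invr_gt0 ltr0n invf_le1 ?ltr0n// ler1n.
apply/seteqP; split=> [x Ex|x [k _]].
  have [xab nmd] := Ex.
  have [n [m D]] := not_md_chord_defect lip (hmd x xab) nmd.
  by exists (pickle (n, m)) => //; rewrite /A pickleK.
by rewrite /A; case: unpickle => [[n m] []|].
Qed.
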